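(* Let $\vec x,\vec y,\vec p,\vec q$ be four sequences of commuting indeterminates (indexed by $k\ge1$). For every $n\ge0$, $$\sum_{|w|=n}h_w(\vec p\mid\vec q)\,s_w(\vec x\mid\vec y)=\det D_n,$$ where the sum is over all Fibonacci words of weight $n$, and $D_n$ is the $n\times n$ quadridiagonal matrix with $(k,k)$ entry $p_kx_k$, $(k,k+1)$ entry $y_k(p_kp_{k+1}-q_k)$, $(k,k+2)$ entry $-q_kx_ky_{k+1}p_{k+2}$, $(k+1,k)$ entry $1$, and all other entries $0$.
   Context: A Fibonacci word is a finite (possibly empty) word $w$ in the letters $1,2$; its weight $|w|$ is the sum of its letters. For sequences $\vec x,\vec y$: $A_\ell$ ($A_0=1$) is the determinant of the $\ell\times\ell$ tridiagonal matrix with diagonal $x_1,\ldots,x_\ell$, superdiagonal $y_1,\ldots,y_{\ell-1}$ and subdiagonal entries $1$; $B_k(m)$ ($k,m\ge0$) is the determinant of the $(k+1)\times(k+1)$ tridiagonal matrix with diagonal $y_{m+1},x_{m+3},\ldots,x_{m+k+2}$, superdiagonal $x_{m+1}y_{m+2},y_{m+3},\ldots,y_{m+k+1}$, subdiagonal entries $1$. The clone Schur functions are $s_{1^k}(\vec x\mid\vec y)=A_k$, $s_{1^k2u}(\vec x\mid\vec y)=B_k(|u|)\,s_u(\vec x\mid\vec y)$. The clone homogeneous functions are the monomials defined by $h_\varnothing=1$, $h_{1v}(\vec p\mid\vec q)=p_{|v|+1}h_v(\vec p\mid\vec q)$, $h_{2v}(\vec p\mid\vec q)=q_{|v|+1}h_v(\vec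 p\mid\vec q)$. *)

(* Defs.v *)
From HB Require Import structures.
From mathcomp Require Import all_boot all_algebra.

Set Implicit Arguments.
Unset Strict Implicit.
Unset Printing Implicit Defensive.

Import GRing.Theory.
Local Open Scope ring_scope.

Inductive letter := One | Two.

Definition bool_of_letter (a : letter) : bool := if a is Two then true else false.
Definition letter_of_bool (b : bool) : letter := if b then Two else One.
Lemma bool_of_letterK : cancel bool_of_letter letter_of_bool.
Proof. by case. Qed.

HB.instance Definition _ := Finite.copy letter (can_type bool_of_letterK).

Definition fibword := seq letter.

Definition letter_val (a : letter) : nat := if a is Two then 2%N else 1%N.

Definition weight (w : fibword) : nat := (\sum_(a <- w) letter_val a)%N.

(* Hence the words of weight n all lie in the finite type n.-bseq letter of
   words of length at most n. *)
Lemma size_le_weight (w : fibword) : (size w <= weight w)%N.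
Proof.
rewrite /weight -sum1_size; apply: leq_sum => a _.
by case: a.
Qed.

Section CloneSchur.
Variable R : comNzRingType.

(* Sequences indexed by k >= 1 are functions nat -> R whose value at 0 is
   never used; an ordinal i : 'I_n stands for the 1-based index i.+1. *)
Implicit Types x y p q d e : nat -> R.

Definition tridiag d e (n : nat) : 'M[R]_n :=
  \matrix_(i < n, j < n)
    if j == i :> nat then d i.+1
    else if j == i.+1 :> nat then e i.+1
    else if i == j.+1 :> nat then 1
    else 0.

Definition cloneA x y (l : nat) : R := \det (tridiag x y l).

Definition cloneB x y (k m : nat) : R :=
  \det (tridiag (fun i => if i == 1%N then y m.+1 else x (m + i.+1)%N)
                (fun i => if i == 1%N then x m.+1 * y m.+2 else y (m + i.+1)%N)
                k.+1).

(* [clone_schur_rec x y k w] is s_{1^k w}(x | y). *)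
Fixpoint clone_schur_rec x y (k : nat) (w : fibword) : R :=
  match w with
  | [::] => cloneA x y k
  | One :: v => clone_schur_rec x y k.+1 v
  | Two :: u => cloneB x y k (weight u) * clone_schur_rec x y 0 u
  end.

Definition clone_schur x y (w : fibword) : R := clone_schur_rec x y 0 w.

Lemma clone_schur_ones x y k : clone_schur x y (nseq k One) = cloneA x y k.
Proof.
suff H m : clone_schur_rec x y m (nseq k One) = cloneA x y (m + k) by exact: H.
by elim: k m => [|k IHk] m /=; rewrite ?addn0 // IHk addSnnS.
Qed.

Lemma clone_schur_two x y k (u : fibword) :
  clone_schur x y (nseq k One ++ Two :: u)
    = cloneB x y k (weight u) * clone_schur x y u.
Proof.
suff H m : clone_schur_rec x y m (nseq k One ++ Two :: u)
    = cloneB x y (m + k) (weight u) * clone_schur x y u by exact: H.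
by elim: k m => [|k IHk] m /=; rewrite ?addn0 // IHk addSnnS.
Qed.

Fixpoint clone_h p q (w : fibword) : R :=
  match w with
  | [::] => 1
  | One :: v => p (weight v).+1 * clone_h p q v
  | Two :: v => q (weight v).+1 * clone_h p q v
  end.

Definition quadridiag x y p q (n : nat) : 'M[R]_n :=
  \matrix_(i < n, j < n)
    let k := i.+1 in
    if j == i :> nat then p k * x k
    else if j == i.+1 :> nat then y k * (p k * p k.+1 - q k)
    else if j == i.+2 :> nat then - (q k * x k * y k.+1 * p k.+2)
    else if i == j.+1 :> nat then 1
    else 0.

End CloneSchur.

(* Main.v *)
(* Write S_n for the left-hand side. Expanding the defining determinants of the
   clone Schur functions gives, with n the weight of the word on the left,
     s_{11v} = x_n s_{1v} - y_{n-1} s_v   and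
     s_{12u} = x_n s_{2u} - x_{n-2} y_{n-1} s_u.
   Splitting S_n over words beginning with 11, 12 and 2 therefore yields
     S_n = p_n x_n S_{n-1} - y_{n-1} (p_{n-1} p_n - q_{n-1}) S_{n-2}
           - q_{n-2} x_{n-2} y_{n-1} p_n S_{n-3},
   which is the expansion of det D_n along its last column. *)
Require Import Defs.
From mathcomp Require Import all_boot all_algebra.
From mathcomp Require Import ring zify.

Local Open Scope ring_scope.

Import GRing.Theory.

(** * Enumeration of Fibonacci words by weight *)

(** Built by first letter, so that splitting a sum at the first letter is just [big_cat]. The inner
    match is there because no word of weight 1 begins with [Two]. *)
Fixpoint words (n : nat) : seq fibword :=
  if n is n'.+1 then
    map (cons One) (words n')
      ++ (if n' is m.+1 then map (cons Two) (words m) else [::])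
  else [:: [::]].

Lemma weight_nil : weight [::] = 0%N.
Proof. by rewrite /weight big_nil. Qed.

Lemma weight_cons a w : weight (a :: w) = (letter_val a + weight w)%N.
Proof. by rewrite /weight big_cons. Qed.

Lemma mem_words n w : (w \in words n) = (weight w == n).
Proof.
have cons_inj a : injective (cons a : fibword -> fibword) by move=> u v [].
have memN a b u s : a != b -> (a :: u \in map (cons b) s) = false.
  by move=> ab; apply/mapP => -[v _ [/eqP]]; rewrite (negbTE ab).
elim: w n => [|a w IHw] n.
  rewrite weight_nil; case: n => [|n] //=; rewrite mem_cat.
  apply/norP; split; first by apply/mapP => -[].
  by case: n => [|n] //; apply/mapP => -[].
rewrite weight_cons; case: n => [|n]; first by case: a.
case: a => /=; rewrite mem_cat.
  rewrite mem_map // IHw add1n eqSS; case: n => [|n]; first by rewrite orbF.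
  by rewrite memN ?orbF.
rewrite memN //=; case: n => [|n]; first by [].
by rewrite mem_map // IHw.
Qed.

Lemma uniq_words n : uniq (words n).
Proof.
have cons_inj a : injective (cons a : fibword -> fibword) by move=> u v [].
elim/ltn_ind: n => -[|n] IHn //=.
rewrite cat_uniq map_inj_uniq // IHn //=; case: n IHn => [|n] IHn //.
rewrite map_inj_uniq // IHn ?andbT //.
by apply/hasPn => _ /mapP[u _ ->]; apply/mapP => -[].
Qed.

Section Expansions.
Variable R : comNzRingType.
Implicit Types (x y p q d e c : nat -> R) (g : nat -> nat -> R).
Implicit Types f : fibword -> R.

(** Both index lists are duplicate-free with the same members, hence permutations of each other. *)
Lemma sum_bseq_words f n :
  \sum_(w : n.-bseq letter | weight w == n) f w = \sum_(w <- words n) f w.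
Proof.
rewrite -big_filter -(big_map val predT f); apply: perm_big.
apply: uniq_perm; [|exact: uniq_words|].
  rewrite map_inj_uniq; last exact: val_inj.
  by rewrite filter_uniq ?index_enum_uniq.
move=> w; rewrite mem_words; apply/mapP/eqP => [[v]|ww].
  by rewrite mem_filter => /andP[/eqP vn _] ->.
have sw : (size w <= n)%N by rewrite -ww size_le_weight.
by exists (Bseq sw); rewrite // mem_filter mem_index_enum /= ww eqxx.
Qed.

Lemma sum_words2 f n :
  \sum_(w <- words n.+2) f w
    = \sum_(w <- words n.+1) f (One :: w) + \sum_(w <- words n) f (Two :: w).
Proof. by rewrite [words n.+2]/= big_cat /= -/(words n.+1) !big_map. Qed.

Lemma sum_words1 f :
  \sum_(w <- words 1) f w = f [:: One].
Proof. by rewrite /= big_seq1. Qed.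

(** * Determinants of Hessenberg matrices *)

(** Entries come from one array on naturals, counted from 0, so the leading principal minors of all
    sizes share the same [g]. *)
Definition hess g n : 'M[R]_n := \matrix_(i < n, j < n) g i j.

(** The last row has at most two nonzero entries. Deleting it with the column of its subdiagonal 1
    brings the last column next to a smaller Hessenberg block; leaving that column an arbitrary [c]
    lets the induction go through. *)
Lemma det_hess_col g c n :
    (forall i j, (j.+1 < i)%N -> g i j = 0) -> (forall j, g j.+1 j = 1) ->
  \det (hess (fun i j => if j == n then c i else g i j) n.+1)
    = \sum_(k < n.+1) (-1) ^+ (n - k) * c k * \det (hess g k).
Proof.
move=> g0 g1; elim: n => [|n IHn].
  rewrite big_ord_recr big_ord0 /= det_mx11 mxE /= det_mx00; ring.
rewrite (expand_det_row _ ord_max) [RHS]big_ord_recr.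
rewrite [LHS]big_ord_recr [X in X + _ = _]big_ord_recr /= big1 ?add0r; last first.
  by move=> i _; rewrite !mxE /= ltn_eqF ?g0 ?mul0r //=; have := ltn_ord i; lia.
rewrite !mxE /= eqxx ltn_eqF ?ltnSn // g1 mul1r /cofactor /=.
rewrite addnn; set M1 := row' _ _; set M2 := row' _ (col' ord_max _).
have -> : M1 = hess (fun i j => if j == n then c i else g i j) n.+1.
  apply/matrixP => i j; rewrite !mxE !lift_max /= /bump.
  have := ltn_ord j; rewrite ltnS leq_eqVlt => /orP[/eqP->|jn].
    by rewrite leqnn add1n !eqxx.
  by rewrite leqNgt jn add0n !ltn_eqF // ltnW.
have -> : M2 = hess g n.+1.
  by apply/matrixP => i j; rewrite !mxE !lift_max ltn_eqF.
rewrite IHn subnn [in LHS]addnC; congr (_ + _).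
  rewrite addnS addnn exprS -signr_odd odd_double expr0 mulr1 big_distrr /=.
  by apply: eq_bigr => k _; rewrite subSn ?exprS ?mulrA // -ltnS.
by rewrite -signr_odd odd_double; ring.
Qed.

Lemma det_hess g n :
    (forall i j, (j.+1 < i)%N -> g i j = 0) -> (forall j, g j.+1 j = 1) ->
  \det (hess g n.+1)
    = \sum_(k < n.+1) (-1) ^+ (n - k) * g k n * \det (hess g k).
Proof.
move=> g0 g1; rewrite -(det_hess_col g (fun i => g i n)) //; congr (\det _).
by apply/matrixP => i j; rewrite !mxE; case: eqP => [->|].
Qed.

Lemma det_tridiag1 d e : \det (tridiag d e 1) = d 1%N.
Proof. by rewrite det_mx11 mxE. Qed.

Lemma det_tridiag d e n :
  \det (tridiag d e n.+2)
    = d n.+2 * \det (tridiag d e n.+1) - e n.+1 * \det (tridiag d e n).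
Proof.
pose g i j := if j == i then d i.+1 else if j == i.+1 then e i.+1
  else if i == j.+1 then 1 else 0 : R.
have E k : tridiag d e k = hess g k by [].
rewrite !E det_hess; first last.
- by move=> j; rewrite /g eqxx !ltn_eqF.
- by move=> i j ij; rewrite /g !ifF //; lia.
rewrite !big_ord_recr big1 /= ?add0r; last first.
  by move=> i _; rewrite /g !ifF ?mulr0 ?mul0r //; have := ltn_ord i; lia.
rewrite subnn subSnn /g !eqxx ifF; last by lia.
ring.
Qed.

Lemma quadridiagE x y p q n :
  quadridiag x y p q n = hess (fun i j =>
    if j == i then p i.+1 * x i.+1
    else if j == i.+1 then y i.+1 * (p i.+1 * p i.+2 - q i.+1)
    else if j == i.+2 then - (q i.+1 * x i.+1 * y i.+2 * p i.+3)
    else if i == j.+1 then 1 else 0) n.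
Proof. by []. Qed.

Lemma det_quadridiag1 x y p q : \det (quadridiag x y p q 1) = p 1%N * x 1%N.
Proof. by rewrite det_mx11 mxE. Qed.

(** The three terms come from the last column. The default 0 reflects that a matrix of size 2 has no
    second superdiagonal. *)
Lemma det_quadridiag x y p q n :
  \det (quadridiag x y p q n.+2)
    = p n.+2 * x n.+2 * \det (quadridiag x y p q n.+1)
      - y n.+1 * (p n.+1 * p n.+2 - q n.+1) * \det (quadridiag x y p q n)
      - (if n is m.+1 then q n * x n * y n.+1 * p n.+2
           * \det (quadridiag x y p q m) else 0).
Proof.
rewrite !quadridiagE det_hess; first last.
- by move=> j; rewrite eqxx !ltn_eqF //; lia.
- by move=> i j ij; rewrite !ifF //; lia.
case: n => [|n].
  by rewrite !big_ord_recr big_ord0 /=; ring.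
rewrite !big_ord_recr big1 /= ?add0r; last first.
  by move=> i _; rewrite !ifF ?mulr0 ?mul0r //; have := ltn_ord i; lia.
rewrite quadridiagE subnn subSnn -(addn2 n) addKn addn2 !eqxx !ifF; try lia.
ring.
Qed.

(** * Recurrences for clone Schur functions *)

(** Leading ones pass into the counter until a 2 or the end of the word; there it is the recurrence
    of a tridiagonal determinant. With at least two ones before the 2, the exceptional first entries
    of [cloneB] are not reached. *)
Lemma clone_schur_rec2 x y k w :
  clone_schur_rec x y k.+2 w
    = x (weight w + k.+2)%N * clone_schur_rec x y k.+1 w
      - y (weight w + k.+1)%N * clone_schur_rec x y k w.
Proof.
elim: w k => [|[] w IHw] k /=.
- by rewrite weight_nil /cloneA det_tridiag.
- by rewrite IHw weight_cons /= !addnS.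
- rewrite /cloneB det_tridiag /= weight_cons !addSn !addnS.
  ring.
Qed.

Lemma cloneB0 x y m : cloneB x y 0 m = y m.+1.
Proof. by rewrite /cloneB det_tridiag1. Qed.

(** Here the recurrence does meet the exceptional superdiagonal entry, which sets words 12u apart
    from words 11v. *)
Lemma cloneB1 x y m :
  cloneB x y 1 m = x m.+3 * y m.+1 - x m.+1 * y m.+2.
Proof.
by rewrite /cloneB det_tridiag det_tridiag1 /= det_mx00 mulr1 !addnS addn0.
Qed.

Lemma clone_schur11 x y w :
  clone_schur x y (One :: One :: w)
    = x (weight w).+2 * clone_schur x y (One :: w)
      - y (weight w).+1 * clone_schur x y w.
Proof. by rewrite /clone_schur /= clone_schur_rec2 addn2 addn1. Qed.

Lemma clone_schur12 x y w :
  clone_schur x y (One :: Two :: w)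
    = x (weight w).+3 * clone_schur x y (Two :: w)
      - x (weight w).+1 * y (weight w).+2 * clone_schur x y w.
Proof. rewrite /clone_schur /= cloneB0 cloneB1; ring. Qed.

(** * Recurrence for the sum over words *)

Definition clone_sum x y p q n : R :=
  \sum_(w <- words n) clone_h p q w * clone_schur x y w.

Lemma clone_sum0 x y p q : clone_sum x y p q 0 = 1.
Proof. by rewrite /clone_sum big_seq1 /clone_schur /= /cloneA det_mx00 mulr1. Qed.

Lemma clone_sum1 x y p q : clone_sum x y p q 1 = p 1%N * x 1%N.
Proof.
by rewrite /clone_sum sum_words1 /clone_schur /= /cloneA det_tridiag1
  weight_nil mulr1.
Qed.

Lemma clone_sum_two x y p q n :
  \sum_(w <- words n) clone_h p q (Two :: w) * clone_schur x y (Two :: w)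
    = q n.+1 * y n.+1 * clone_sum x y p q n.
Proof.
rewrite /clone_sum big_distrr /=; apply: eq_big_seq => w.
by rewrite mem_words => /eqP <-; rewrite /clone_schur /= cloneB0; ring.
Qed.

(** Separate from the general case because the prefix 12 already has weight 3. *)
Lemma clone_sum2 x y p q :
  clone_sum x y p q 2
    = p 2%N * x 2%N * clone_sum x y p q 1
      - y 1%N * (p 1%N * p 2%N - q 1%N) * clone_sum x y p q 0.
Proof.
rewrite /(clone_sum _ _ _ _ 2) sum_words2 sum_words1 clone_sum_two.
rewrite clone_sum1 clone_sum0 clone_schur11 /clone_schur /= /cloneA.
rewrite det_tridiag1 det_mx00 weight_cons weight_nil /=; ring.
Qed.

Lemma clone_sum3 x y p q n :
  clone_sum x y p q n.+3
    = p n.+3 * x n.+3 * clone_sum x y p q n.+2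
      - y n.+2 * (p n.+2 * p n.+3 - q n.+2) * clone_sum x y p q n.+1
      - q n.+1 * x n.+1 * y n.+2 * p n.+3 * clone_sum x y p q n.
Proof.
have E1 : \sum_(w <- words n.+1)
      clone_h p q [:: One, One & w] * clone_schur x y [:: One, One & w]
    = p n.+3 * x n.+3 * \sum_(w <- words n.+1)
        clone_h p q (One :: w) * clone_schur x y (One :: w)
      - p n.+2 * p n.+3 * y n.+2 * clone_sum x y p q n.+1.
  rewrite /clone_sum !big_distrr -sumrB; apply: eq_big_seq => w.
  rewrite mem_words => /eqP ww; rewrite clone_schur11 /= weight_cons ww add1n.
  ring.
have E2 : \sum_(w <- words n)
      clone_h p q [:: One, Two & w] * clone_schur x y [:: One, Two & w]
    = p n.+3 * x n.+3 * \sum_(w <- words n)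
        clone_h p q (Two :: w) * clone_schur x y (Two :: w)
      - q n.+1 * x n.+1 * y n.+2 * p n.+3 * clone_sum x y p q n.
  rewrite /clone_sum !big_distrr -sumrB; apply: eq_big_seq => w.
  rewrite mem_words => /eqP ww; rewrite clone_schur12 /= weight_cons ww add2n.
  ring.
rewrite /(clone_sum _ _ _ _ n.+3) sum_words2 sum_words2 clone_sum_two E1 E2.
(* The leading terms of [E1] and [E2] reassemble into the sum of weight [n.+2], split at its first
   letter. *)
rewrite [clone_sum _ _ _ _ n.+2]/clone_sum sum_words2.
ring.
Qed.

End Expansions.

Theorem proposition3p9 (R : comNzRingType) (x y p q : nat -> R) (n : nat) :
  \sum_(w : n.-bseq letter | weight w == n) clone_h p q w * clone_schur x y w
    = \det (quadridiag x y p q n).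
Proof.
rewrite (sum_bseq_words _ (fun w => clone_h p q w * clone_schur x y w)).
rewrite -/(clone_sum _ x y p q n).
(* The recurrence reaches back three weights, so weights 0, 1 and 2 are base cases. *)
elim/ltn_ind: n => -[|[|[|n]]] IHn.
- by rewrite clone_sum0 det_mx00.
- by rewrite clone_sum1 det_quadridiag1.
- by rewrite clone_sum2 det_quadridiag !IHn // subr0.
- by rewrite clone_sum3 det_quadridiag !IHn //; lia.
Qed.
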